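(* Assume that the sequence $\{A^k\}$, $A^k=(L^k,S^k,U^k,V^k;\Lambda^k,\Theta^k)$, generated by the $\ell_0$ ADMM algorithm converges, and that its cluster point (limit) $A^*=(L^*,S^*,U^*,V^*;\Lambda^*,\Theta^* )$ is still feasible for the problem $\min_{(L,S)\in\mathscr D}F(L,S)$, i.e. $(L^*,S^* )\in\mathscr D$. Then $(L^*,S^* )$ is a P-stationary point of this problem, and hence a local minimizer of it.
   Context: Fix a positive integer $p$, real $C>0$, $\mu>0$, and a symmetric positive definite $\check\Sigma\in\mathbb R^{p\times p}$. All matrices are real symmetric $p\times p$; $O$ is the zero matrix; $\|\cdot\|_{\mathrm F}$ is the Frobenius norm; $\|S\|_0$ is the number of nonzero entries of $S$; $\langle A,B\rangle=\operatorname{tr}(AB^\top)$. Let $\mathscr D=\{(L,S):L\succeq0,\ S\succeq0,\ L+S\succ0\}$, $$f(L,S)=\operatorname{tr}(L)+\mu\{\operatorname{tr}[(L+S)\check\Sigma^{-1}]-\log\det(L+S)\},\qquad F(L,S)=f(L,S)+C\|S\|_0.$$ A local minimizer is a point $(L^*,S^* )\in\mathscr D$ for which there is $\delta>0$ with $F(L^*,S^* )\le F(L,S)$ for all $(L,S)\in\mathscr D$ with $\|(L,S)-(L^*,S^* )\|_{\mathrm F}<\delta$. Proximal operator: for $\gamma>0$, $\operatorname{prox}_{\gamma C\|\cdot\|_0}(T)$ is the matrix with $(i,j)$ entry $0$ if $|t_{ij}|\le\sqrt{2\gamma C}$ and $t_{ij}$ otherwise. P-stationary point: $(L^*,S^*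 )$ is a P-stationary point of $\min_{(L,S)\in\mathscr D}F(L,S)$ if there exist $p\times p$ symmetric matrices $\Lambda^*,\Theta^*$ and a real $\gamma>0$ such that $L^*\succeq0$, $S^*\succeq0$; $L^*+S^*\succ0$; $\Lambda^*\succeq0$, $\Theta^*\succeq0$; $\operatorname{tr}(\Lambda^*L^* )=0$, $\operatorname{tr}(\Theta^*S^* )=0$; $\nabla_Lf(L^*,S^* )-\Lambda^*=O$; and $\operatorname{prox}_{\gamma C\|\cdot\|_0}[S^*-\gamma(\nabla_Sf(L^*,S^* )-\Theta^* )]=S^*$. The $\ell_0$ ADMM with penalty parameter $\rho>0$ and step size $\gamma>0$. Let $\Pi_+$ be the orthogonal projection of symmetric matrices onto the cone of positive semidefinite matrices. Initialization: with spectral decomposition $\check\Sigma=QJQ^\top$, $J=\operatorname{diag}(\tau_1,\dots,\tau_p)$, $\tau_1\ge\dots\ge\tau_p$, and some $d<p$, put $L^0=Q\operatorname{diag}(\tau_1,\dots,\tau_d,0,\dots,0)Q^\top$, $S^0=\check\Sigma-L^0$, $U^0=L^0$, $V^0=S^0$, $\Lambda^0=\Theta^0=0$. Iteration for $k\ge0$: - $L^{k+1}=\operatorname{argmin}_{L}\ f(L,S^k)-\langle\Lambda^k,L\rangle+\frac\rho2\|L-U^k\|_{\mathrm F}^2$, i.e. $L^{k+1}=\frac{\mu}{2\rho}X^k\big(\sqrt{(D^k)^2+\frac{4\rho}{\mu}I}-D^k\big)(X^k)^\top-S^k$, where $X^kD^k(X^k)^\top$ is the spectral decomposition of $\frac1\mu\big(I-\Lambda^k+\mu\check\Sigma^{-1}-\rho(S^k+U^k)\big)$;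 - $S^{k+1}=\operatorname{prox}_{\gamma C\|\cdot\|_0}\big[S^k-\gamma(\nabla_Sf(L^{k+1},S^k)-\Theta^k+\rho(S^k-V^k))\big]$; - $U^{k+1}=\Pi_+(L^{k+1}-\frac1\rho\Lambda^k)$; - $V^{k+1}=\Pi_+(S^{k+1}-\frac1\rho\Theta^k)$; - $\Lambda^{k+1}=\Lambda^k-\rho(L^{k+1}-U^{k+1})$; - $\Theta^{k+1}=\Theta^k-\rho(S^{k+1}-V^{k+1})$. *)

(* Defs.v *)
From HB Require Import structures.
From mathcomp Require Import all_boot all_order all_algebra.
From mathcomp Require Import all_classical all_reals all_analysis.

Set Implicit Arguments.
Unset Strict Implicit.
Unset Printing Implicit Defensive.

Import Order.TTheory GRing.Theory Num.Theory.
Import numFieldNormedType.Exports.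

Local Open Scope ring_scope.

Definition symm_mx (R : realType) (p : nat) (A : 'M[R]_p) : Prop := A^T = A.

Definition psd (R : realType) (p : nat) (A : 'M[R]_p) : Prop :=
  symm_mx A /\ forall x : 'cV[R]_p, 0 <= (x^T *m A *m x) 0 0.

Definition posdef (R : realType) (p : nat) (A : 'M[R]_p) : Prop :=
  symm_mx A /\ forall x : 'cV[R]_p, x != 0 -> 0 < (x^T *m A *m x) 0 0.

Definition inner (R : realType) (p : nat) (A B : 'M[R]_p) : R :=
  \tr (A *m B^T).

Definition frob (R : realType) (p : nat) (A : 'M[R]_p) : R :=
  Num.sqrt (inner A A).

Definition frob2 (R : realType) (p : nat) (A B : 'M[R]_p) : R :=
  Num.sqrt (frob A ^+ 2 + frob B ^+ 2).

Definition norm0 (R : realType) (p : nat) (S : 'M[R]_p) : R :=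
  #|[set ij : 'I_p * 'I_p | S ij.1 ij.2 != 0]|%:R.

(* The gradient of [g], as a function on the space of symmetric matrices with
   inner product tr(A B^T): it is the symmetric matrix G whose pairing with a
   symmetric direction H is the derivative of g along H, and the entry G_ij is
   the pairing with H = (E_ij + E_ji) / 2. *)
Definition grad (R : realType) (p : nat) (g : 'M[R]_p -> R) (X : 'M[R]_p) :
    'M[R]_p :=
  \matrix_(i, j) 'D_(2^-1 *: (delta_mx i j + delta_mx j i)) g X.

Definition feasible (R : realType) (p : nat) (L S : 'M[R]_p) : Prop :=
  [/\ psd L, psd S & posdef (L + S)].

Definition smooth_obj (R : realType) (p : nat) (mu : R) (Sigma : 'M[R]_p)
    (L S : 'M[R]_p) : R :=
  \tr L + mu * (\tr ((L + S) *m invmx Sigma) - ln (\det (L + S))).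

Definition grad_L (R : realType) (p : nat) (mu : R) (Sigma : 'M[R]_p)
    (L S : 'M[R]_p) : 'M[R]_p :=
  grad (fun X => smooth_obj mu Sigma X S) L.

Definition grad_S (R : realType) (p : nat) (mu : R) (Sigma : 'M[R]_p)
    (L S : 'M[R]_p) : 'M[R]_p :=
  grad (fun Y => smooth_obj mu Sigma L Y) S.

Definition obj (R : realType) (p : nat) (C mu : R) (Sigma : 'M[R]_p)
    (L S : 'M[R]_p) : R :=
  smooth_obj mu Sigma L S + C * norm0 S.

Definition local_minimizer (R : realType) (p : nat) (C mu : R)
    (Sigma : 'M[R]_p) (Ls Ss : 'M[R]_p) : Prop :=
  feasible Ls Ss /\
  exists2 delta : R, 0 < delta &
    forall L S : 'M[R]_p, feasible L S -> frob2 (L - Ls) (S - Ss) < delta ->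
      obj C mu Sigma Ls Ss <= obj C mu Sigma L S.

(* Hard thresholding; on the boundary |t| = sqrt (2 gamma C), where the
   proximal operator is two-valued, the value 0 is selected. *)
Definition prox0 (R : realType) (p : nat) (gamma C : R) (T : 'M[R]_p) :
    'M[R]_p :=
  \matrix_(i, j) if `|T i j| <= Num.sqrt (2 * gamma * C) then 0 else T i j.

Definition P_stationary (R : realType) (p : nat) (C mu : R)
    (Sigma : 'M[R]_p) (Ls Ss : 'M[R]_p) : Prop :=
  exists (Lam Theta : 'M[R]_p) (gamma : R),
    [/\ 0 < gamma, symm_mx Lam & symm_mx Theta] /\
    [/\ psd Ls, psd Ss & posdef (Ls + Ss)] /\
    [/\ psd Lam, psd Theta, \tr (Lam *m Ls) = 0 & \tr (Theta *m Ss) = 0] /\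
    grad_L mu Sigma Ls Ss - Lam = 0 /\
    prox0 gamma C (Ss - gamma *: (grad_S mu Sigma Ls Ss - Theta)) = Ss.

(* P = Pi_+(M): orthogonal projection, for the Frobenius norm. *)
Definition psd_proj (R : realType) (p : nat) (M P : 'M[R]_p) : Prop :=
  psd P /\ forall Q : 'M[R]_p, psd Q -> frob (M - P) <= frob (M - Q).

Definition L_subproblem (R : realType) (p : nat) (mu rho : R)
    (Sigma S U Lam : 'M[R]_p) (L : 'M[R]_p) : R :=
  smooth_obj mu Sigma L S - inner Lam L + rho / 2 * frob (L - U) ^+ 2.

(* [ln] is total: the constraint [posdef (L + S)] is the usual domain of
   -log det on symmetric matrices. *)
Definition L_argmin (R : realType) (p : nat) (mu rho : R)
    (Sigma S U Lam : 'M[R]_p) (Lnew : 'M[R]_p) : Prop :=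
  (symm_mx Lnew /\ posdef (Lnew + S)) /\
  forall L : 'M[R]_p, symm_mx L -> posdef (L + S) ->
    L_subproblem mu rho Sigma S U Lam Lnew
      <= L_subproblem mu rho Sigma S U Lam L.

Definition admm_init_LS (R : realType) (p : nat) (Sigma L0 S0 : 'M[R]_p) :
    Prop :=
  exists (Q : 'M[R]_p) (tau : 'rV[R]_p) (d : nat),
    [/\ Q *m Q^T = 1%:M,
        Sigma = Q *m diag_mx tau *m Q^T &
        forall i j : 'I_p, (i <= j)%N -> tau 0 j <= tau 0 i] /\
    [/\ (d < p)%N,
        L0 = Q *m diag_mx (\row_i (if (i < d)%N then tau 0 i else 0)) *m Q^T &
        S0 = Sigma - L0].

Record l0_admm (R : realType) (p : nat) (C mu : R) (Sigma : 'M[R]_p)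
    (rho gamma : R) (L S U V Lam Theta : nat -> 'M[R]_p) : Prop := L0Admm {
  admm_init : admm_init_LS Sigma (L 0%N) (S 0%N);
  admm_U0 : U 0%N = L 0%N;
  admm_V0 : V 0%N = S 0%N;
  admm_Lam0 : Lam 0%N = 0;
  admm_Theta0 : Theta 0%N = 0;
  admm_L : forall k : nat,
    L_argmin mu rho Sigma (S k) (U k) (Lam k) (L k.+1);
  admm_S : forall k : nat,
    S k.+1 = prox0 gamma C
      (S k - gamma *: (grad_S mu Sigma (L k.+1) (S k) - Theta k
                        + rho *: (S k - V k)));
  admm_U : forall k : nat, psd_proj (L k.+1 - rho^-1 *: Lam k) (U k.+1);
  admm_V : forall k : nat, psd_proj (S k.+1 - rho^-1 *: Theta k) (V k.+1);
  admm_Lam : forall k : nat, Lam k.+1 = Lam k - rho *: (L k.+1 - U k.+1);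
  admm_Theta : forall k : nat,
    Theta k.+1 = Theta k - rho *: (S k.+1 - V k.+1)
}.

(* Main.v *)
(* Existence of limits makes the residuals L^k - U^k and S^k - V^k vanish, and
   Moreau's decomposition for the self-dual cone of positive semidefinite
   matrices gives the sign and complementarity of the multipliers.  The
   optimality condition of the L-step, and the thresholding of the S-step entry
   by entry, then pass to the limit, because the gradient
   mu (Sigma^-1 - (L + S)^-1) of the smooth part is continuous.
   Everything about ln det follows from the Cholesky factorization: it yields
   ln det M <= tr M - p, hence the tangent inequality expressing concavity, and
   the two-sided tangent inequality identifies the derivative.
   A P-stationary point is a local minimizer because the smooth part is convex
   and, nearby, the support of S can only grow, at cost C per entry. *)

Require Import Defs.
From HB Require Import structures.
From mathcomp Require Import all_boot all_order all_algebra.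
From mathcomp Require Import all_classical all_reals all_analysis.
From mathcomp Require Import ring lra.
Import Order.TTheory GRing.Theory Num.Theory.
Import numFieldNormedType.Exports.
Local Open Scope ring_scope.
Local Open Scope classical_set_scope.

Set Implicit Arguments.
Unset Strict Implicit.

(** * Quadratic forms, semidefinite matrices and Cholesky factorization *)

Definition bilform (R : realType) (p : nat) (A : 'M[R]_p) (x y : 'cV[R]_p) : R :=
  (x^T *m A *m y) 0 0.

Section PositiveSemidefinite.
Context {R : realType} {p : nat}.
Implicit Types (A B C H M P X : 'M[R]_p) (x y : 'cV[R]_p).

Lemma bilformC A x y : symm_mx A -> bilform A x y = bilform A y x.
Proof.
move=> symA; rewrite /bilform -[RHS](mxE trmx_key (fun i j => (y^T *m A *m x) j i)).
by rewrite -/(_^T) !trmx_mul trmxK symA mulmxA.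
Qed.

Lemma bilformDl A x y z : bilform A (x + y) z = bilform A x z + bilform A y z.
Proof. by rewrite /bilform linearD !mulmxDl mxE. Qed.

Lemma bilformDr A x y z : bilform A z (x + y) = bilform A z x + bilform A z y.
Proof. by rewrite /bilform mulmxDr mxE. Qed.

Lemma bilformZl A a x z : bilform A (a *: x) z = a * bilform A x z.
Proof. by rewrite /bilform linearZ -!scalemxAl mxE. Qed.

Lemma bilformZr A a x z : bilform A z (a *: x) = a * bilform A z x.
Proof. by rewrite /bilform -scalemxAr mxE. Qed.

Lemma bilformDm A B x y : bilform (A + B) x y = bilform A x y + bilform B x y.
Proof. by rewrite /bilform mulmxDr mulmxDl mxE. Qed.

Lemma bilformZm a A x y : bilform (a *: A) x y = a * bilform A x y.
Proof. by rewrite /bilform -scalemxAr -scalemxAl mxE. Qed.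

Lemma bilform_congr A C x y :
  bilform (C^T *m A *m C) x y = bilform A (C *m x) (C *m y).
Proof. by rewrite /bilform trmx_mul !mulmxA. Qed.

Lemma bilform_delta A i j :
  bilform A (delta_mx i 0) (delta_mx j 0) = A i j.
Proof. by rewrite /bilform trmx_delta -rowE -colE !mxE. Qed.

Lemma symm_mxD A B : symm_mx A -> symm_mx B -> symm_mx (A + B).
Proof. by rewrite /symm_mx linearD /= => -> ->. Qed.

Lemma symm_mxZ a A : symm_mx A -> symm_mx (a *: A).
Proof. by rewrite /symm_mx linearZ /= => ->. Qed.

Lemma symm_mxB A B : symm_mx A -> symm_mx B -> symm_mx (A - B).
Proof. by move=> sA /(symm_mxZ (-1)); rewrite scaleN1r; exact: symm_mxD. Qed.

Lemma symm_mx_congr A C : symm_mx A -> symm_mx (C^T *m A *m C).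
Proof. by move=> sA; rewrite /symm_mx !trmx_mul trmxK sA mulmxA. Qed.

Lemma symm_mxE A : symm_mx A -> forall i j, A j i = A i j.
Proof. by move=> sA i j; rewrite -[in RHS]sA mxE. Qed.

Lemma symm_outer x : symm_mx (x *m x^T).
Proof. by rewrite /symm_mx trmx_mul trmxK. Qed.

Lemma dotmxC x y : (x^T *m y) 0 0 = (y^T *m x) 0 0.
Proof. by rewrite !mxE; apply: eq_bigr => i _; rewrite !mxE mulrC. Qed.

Lemma outermxE x y i j : (x *m y^T) i j = x i 0 * y j 0.
Proof. by rewrite mxE big_ord1 mxE. Qed.

Lemma bilform_outer x y : bilform (x *m x^T) y y = (y^T *m x) 0 0 ^+ 2.
Proof. by rewrite /bilform mulmxA -mulmxA mxE big_ord1 (dotmxC x) expr2. Qed.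

Lemma psd_outer x : psd (x *m x^T).
Proof.
by split=> [|y]; [exact: symm_outer|rewrite -/(bilform _ _ _) bilform_outer sqr_ge0].
Qed.

Lemma psd_ge0 A x : psd A -> 0 <= bilform A x x.
Proof. by case=> _; apply. Qed.

Lemma psdD A B : psd A -> psd B -> psd (A + B).
Proof.
move=> pA pB; split=> [|x]; first exact: symm_mxD pA.1 pB.1.
by rewrite -/(bilform _ _ _) bilformDm addr_ge0// psd_ge0.
Qed.

Lemma psdZ a A : 0 <= a -> psd A -> psd (a *: A).
Proof.
move=> a0 pA; split=> [|x]; first exact: symm_mxZ pA.1.
by rewrite -/(bilform _ _ _) bilformZm mulr_ge0// psd_ge0.
Qed.

Lemma posdef_psd A : posdef A -> psd A.
Proof.
move=> [sA pA]; split=> // x; have [->|/pA/ltW//] := eqVneq x 0.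
by rewrite mulmx0 mxE.
Qed.

(** The form is nonnegative at every s x + t y; the choice s = y^T A y, t = - x^T A y gives the
    inequality multiplied by y^T A y. *)
Lemma psd_CauchySchwarz A x y : psd A ->
  bilform A x y ^+ 2 <= bilform A x x * bilform A y y.
Proof.
move=> [sA pA].
have q s t : 0 <= s ^+ 2 * bilform A x x + 2 * s * t * bilform A x y
                   + t ^+ 2 * bilform A y y.
  have := pA (s *: x + t *: y); rewrite -/(bilform _ _ _).
  rewrite bilformDl !bilformDr !bilformZl !bilformZr (bilformC y x sA).
  by congr (_ <= _); ring.
have := pA y; rewrite -/(bilform _ _ _) le_eqVlt => /orP[/eqP c0|c0].
  rewrite -c0 mulr0; have [->|b0] := eqVneq (bilform A x y) 0.
    by rewrite expr0n.
  (* When y^T A y = 0 the expression is affine in t; this t makes it equal to - x^T A x - 2, which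
     is negative. *)
  have := q 1 (- (bilform A x x + 1) / bilform A x y).
  have := pA x; rewrite -/(bilform _ _ _) -c0.
  have -> : 2 * 1 * (- (bilform A x x + 1) / bilform A x y) * bilform A x y
          = - 2 * (bilform A x x + 1) by field.
  lra.
have := q (bilform A y y) (- bilform A x y).
have -> : bilform A y y ^+ 2 * bilform A x x +
    2 * bilform A y y * - bilform A x y * bilform A x y +
    (- bilform A x y) ^+ 2 * bilform A y y
  = bilform A y y * (bilform A x x * bilform A y y - bilform A x y ^+ 2) by ring.
by rewrite pmulr_rge0// subr_ge0.
Qed.

(** Induction on the number [k] of rows left to eliminate: the first p - k rows of [M] vanish, and
    subtracting v v^T, with v the scaled pivot column, clears one more. Cauchy-Schwarz keeps the
    remainder semidefinite. *)
Lemma Cholesky A : psd A -> exists2 C : 'M[R]_p, is_trig_mx C & A = C *m C^T.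
Proof.
have main k M : (k <= p)%N -> psd M ->
    (forall i j : 'I_p, (i < p - k)%N -> M i j = 0) ->
    exists C : 'M[R]_p, [/\ is_trig_mx C, forall i j : 'I_p, (j < p - k)%N -> C i j = 0
                & M = C *m C^T].
  elim: k M => [|k IHk] M kp psdM M0.
    have -> : M = 0 by apply/matrixP=> i j; rewrite M0 ?subn0 // mxE.
    exists 0; split; [|by move=> *; rewrite mxE|by rewrite mul0mx].
    by apply/is_trig_mxP => i j _; rewrite mxE.
  have rp : (p - k.+1 < p)%N by rewrite ltn_subrL (leq_trans _ kp).
  pose r := Ordinal rp; pose e : 'cV[R]_p := delta_mx r 0.
  have [sM pM] := psdM.
  pose v : 'cV[R]_p := (Num.sqrt (M r r))^-1 *: col r M.
  have Mrr : 0 <= M r r.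
    by have := pM e; rewrite -/(bilform _ _ _) bilform_delta.
  have eMe : bilform M e e = M r r by rewrite bilform_delta.
  have CS x : bilform M x e ^+ 2 <= bilform M x x * M r r.
    by rewrite -eMe; exact: psd_CauchySchwarz.
  have xv (x : 'cV[R]_p) : (x^T *m v) 0 0 = (Num.sqrt (M r r))^-1 * bilform M x e.
    by rewrite /v -scalemxAr mxE colE mulmxA.
  have psdM' : psd (M - v *m v^T).
    split; first by apply: symm_mxB => //; exact: symm_outer.
    move=> x; rewrite -/(bilform _ _ _) -[- _]scaleN1r bilformDm bilformZm.
    rewrite bilform_outer xv exprMn exprVn sqr_sqrtr// mulN1r subr_ge0.
    have := Mrr; rewrite le_eqVlt => /orP[/eqP <-|M0r].
      by rewrite invr0 mul0r; exact: pM.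
    by rewrite [leLHS]mulrC ler_pdivrMr //; exact: CS.
  have vE i : v i 0 = (Num.sqrt (M r r))^-1 * M i r by rewrite !mxE.
  have kk : (p - k = (p - k.+1).+1)%N by rewrite subnSK.
  have v0 (i : 'I_p) : (i < p - k.+1)%N -> v i 0 = 0.
    by move=> ik; rewrite vE (M0 i) ?mulr0.
  have M'0 (i j : 'I_p) : (i < p - k)%N -> (M - v *m v^T) i j = 0.
    rewrite kk ltnS leq_eqVlt => /orP[/eqP ir|ik]; last first.
      by rewrite 2!mxE outermxE (M0 i)// (v0 i)// mul0r subr0.
    have {ir} -> : i = r by apply: val_inj.
    rewrite 2!mxE outermxE !vE (symm_mxE sM r j).
    have := Mrr; rewrite le_eqVlt => /orP[/eqP M0r|M0r].
      (* Zero pivot: [v] is zero because 0^-1 = 0, and Cauchy-Schwarz makes row [r] of [M] vanish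
         already. *)
      have := CS (delta_mx j 0).
      rewrite [bilform _ _ e]bilform_delta -M0r mulr0 sqrtr0 invr0 !mul0r subr0.
      by rewrite exprn_even_le0//= => /eqP; rewrite (symm_mxE sM r j).
    apply/eqP; rewrite subr_eq0; apply/eqP.
    by rewrite mulrACA -invfM -expr2 sqr_sqrtr// mulKf ?gt_eqF.
  have [C [trC C0 MC]] := IHk _ (ltnW kp) psdM' M'0.
  have C0' : C *m e = 0.
    by rewrite /e -colE; apply/matrixP=> i j; rewrite !mxE C0// kk ltnSn.
  (* [v] is inserted as column [r], which is zero in [C], so the cross terms of the product vanish;
     [v] is zero above row [r], so the factor stays triangular. *)
  exists (C + v *m e^T); split.
  - apply/is_trig_mxP => i j ij; rewrite mxE (is_trig_mxP trC)// add0r.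
    rewrite outermxE [e _ _]mxE.
    have [jr|] := eqVneq j r; last by rewrite mulr0.
    by rewrite v0 ?mul0r//; move: ij; rewrite jr.
  - move=> i j jk; rewrite mxE C0 ?kk 1?ltnS 1?ltnW// add0r.
    rewrite outermxE [e _ _]mxE.
    have [jr|] := eqVneq j r; last by rewrite mulr0.
    by move: jk; rewrite jr ltnn.
  - rewrite linearD /= trmx_mul trmxK mulmxDl !mulmxDr.
    rewrite mulmxA C0' mul0mx addr0 -[v *m e^T *m C^T]mulmxA -trmx_mul C0'.
    rewrite trmx0 mulmx0 add0r mulmxA -[v *m e^T *m e]mulmxA.
    have -> : e^T *m e = 1%:M.
      rewrite /e trmx_delta mul_delta_mx; apply/matrixP=> i j.
      by rewrite !ord1 !mxE eqxx.
    by rewrite mulmx1 -MC subrK.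
move=> psdA; have [|C [trC _ ->]] := main p A (leqnn p) psdA.
  by move=> i j; rewrite subnn.
by exists C.
Qed.

(** With B = C C^T the trace is the sum of c^T A c over the columns c of C. *)
Lemma psd_trace_mul_ge0 A B : psd A -> psd B -> 0 <= \tr (A *m B).
Proof.
move=> psdA /Cholesky[C _ ->]; rewrite mulmxA mxtrace_mulC mulmxA.
by apply: sumr_ge0 => i _; rewrite -bilform_delta bilform_congr psd_ge0.
Qed.

Lemma mxtrace_outer A x : \tr (A *m (x *m x^T)) = bilform A x x.
Proof. by rewrite mulmxA mxtrace_mulC mulmxA /mxtrace big_ord1. Qed.

(** * Positive definite matrices and concavity of log det *)

Lemma posdef_unitmx A : posdef A -> A \in unitmx.
Proof.
move=> [_ pA]; rewrite -row_free_unit -kermx_eq0.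
apply/rowV0P => v /sub_kermxP vA; apply/eqP; rewrite -trmx_eq0.
apply/negP => /negP /pA; rewrite trmxK vA mul0mx mxE ltxx.
by [].
Qed.

Lemma posdef_congr A C : C \in unitmx -> posdef A -> posdef (C^T *m A *m C).
Proof.
move=> uC [sA pA]; split=> [|x x0]; first exact: symm_mx_congr.
rewrite -/(bilform _ _ _) bilform_congr; apply: pA.
by apply: contra_neq x0 => Cx0; rewrite -[x](mulKmx uC) Cx0 mulmx0.
Qed.

Lemma posdef_factor A : posdef A ->
  exists C, [/\ is_trig_mx C, C \in unitmx & A = C *m C^T].
Proof.
move=> pA; have [C trC AC] := Cholesky (posdef_psd pA); exists C; split => //.
by have := posdef_unitmx pA; rewrite AC unitmx_mul => /andP[].
Qed.

Lemma posdef_det_gt0 A : posdef A -> 0 < \det A.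
Proof.
move=> /posdef_factor[C [_ uC ->]]; rewrite det_mulmx det_tr -expr2.
by rewrite exprn_even_gt0//= -unitfE -unitmxE.
Qed.

(* With [A = C C^T] triangular, [ln (det A)] is the sum of [ln (c_ii ^ 2)],
   and [ln x <= x - 1]. *)
Lemma ln_det_le_trace A : posdef A -> ln (\det A) <= \tr A - p%:R.
Proof.
move=> /posdef_factor[C [trC uC ->]].
have Cii i : C i i != 0.
  have : \det C != 0 by rewrite -unitfE -unitmxE.
  by rewrite det_trig// prodf_seq_neq0 => /allP/(_ i (mem_index_enum i)).
have C2 i : 0 < C i i ^+ 2 by rewrite exprn_even_gt0//= Cii.
rewrite det_mulmx det_tr -expr2 det_trig// -prodrXl.
have -> : ln (\prod_i C i i ^+ 2) = \sum_i ln (C i i ^+ 2).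
  pose Q (x s : R) := 0 < x /\ ln x = s.
  suff [] : Q (\prod_i C i i ^+ 2) (\sum_i ln (C i i ^+ 2)) by [].
  apply: big_ind2 => [|x _ y _ [x0 <-] [y0 <-]|i _]; first by split; rewrite ?ln1.
  - by split; [exact: mulr_gt0|rewrite lnM ?posrE].
  - by [].
have -> : p%:R = \sum_(i < p) (1 : R) by rewrite sumr_const card_ord.
rewrite /mxtrace -sumrB; apply: ler_sum => i _.
have ln_le : ln (C i i ^+ 2) <= C i i ^+ 2 - 1.
  have := @le_ln1Dx R (C i i ^+ 2 - 1).
  by rewrite addrCA subrr addr0; apply; have := C2 i; lra.
(* The diagonal entry of C C^T is the sum of the squares of row i, one of which is c_ii ^ 2. *)
apply: le_trans ln_le _; rewrite lerB// mxE (bigD1 i)//= mxE -expr2 lerDl.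
by apply: sumr_ge0 => j _; rewrite mxE -expr2 sqr_ge0.
Qed.

(** Congruence by D with D D^T = A^-1 sends A to the identity and reduces the claim to
    [ln_det_le_trace] for D^T B D. *)
Lemma ln_det_tangent A B : posdef A -> posdef B ->
  ln (\det B) <= ln (\det A) + \tr ((B - A) *m invmx A).
Proof.
move=> pA pB; have [C [_ uC AC]] := posdef_factor pA.
pose D := (invmx C)^T.
have uD : D \in unitmx by rewrite unitmx_tr unitmx_inv.
have AD : D *m D^T = invmx A.
  rewrite -[LHS](mulKmx (posdef_unitmx pA)) [in X in _ *m X]AC.
  rewrite -mulmxA (mulmxA C^T) -trmx_mul mulVmx// trmx1 mul1mx trmxK.
  by rewrite mulmxV// mulmx1.
have := ln_det_le_trace (posdef_congr uD pB).
have -> : \det (D^T *m B *m D) = \det B / \det A.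
  by rewrite -det_inv -AD !det_mulmx; ring.
rewrite -mulmxA mxtrace_mulC -mulmxA AD ln_div ?posrE ?posdef_det_gt0//.
rewrite mulmxBl mulmxV ?posdef_unitmx// raddfB /= mxtrace1.
lra.
Qed.

(** * Stability of positive definiteness along lines *)

Lemma bilform1 x : bilform 1%:M x x = \sum_i x i 0 ^+ 2.
Proof.
by rewrite /bilform mulmx1 mxE; apply: eq_bigr => i _; rewrite mxE expr2.
Qed.

Lemma bilform_bound H x :
  `|bilform H x x| <= (\sum_i \sum_j `|H i j|) * bilform 1%:M x x.
Proof.
have x2 i : x i 0 ^+ 2 <= bilform 1%:M x x.
  by rewrite bilform1 (bigD1 i)//= lerDl sumr_ge0// => j _; exact: sqr_ge0.
have xx i j : `|x i 0 * x j 0| <= bilform 1%:M x x.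
  have := x2 i; have := x2 j; have := sqr_ge0 (x i 0 - x j 0).
  have := sqr_ge0 (x i 0 + x j 0); rewrite ler_norml; nra.
rewrite /bilform mxE exchange_big /= mulr_suml.
apply: le_trans (ler_norm_sum _ _ _) _; apply: ler_sum => j _.
rewrite mxE !mulr_suml; apply: le_trans (ler_norm_sum _ _ _) _.
apply: ler_sum => i _; rewrite mxE mulrAC [_ * H i j]mulrC normrM.
by rewrite ler_wpM2l.
Qed.

(** In the coordinates C^T x, where A = C C^T, the form of A is the squared norm, so the form of H
    is at most K times that of A. The radius 1 / (K + 1) also covers K = 0. *)
Lemma posdef_line A H : posdef A -> symm_mx H ->
  exists2 e : R, 0 < e & forall t, `|t| < e -> posdef (A + t *: H).
Proof.
move=> pA sH; have [C [_ uC AC]] := posdef_factor pA.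
pose D := (invmx C)^T.
pose K := \sum_i \sum_j `|(D^T *m H *m D) i j|.
have K0 : 0 <= K by apply: sumr_ge0 => i _; apply: sumr_ge0.
have HK x : `|bilform H x x| <= K * bilform A x x.
  have xD : x = D *m (C^T *m x) by rewrite mulmxA -trmx_mul mulmxV// trmx1 mul1mx.
  rewrite {1 2}xD -bilform_congr; apply: le_trans (bilform_bound _ _) _.
  by rewrite -bilform_congr trmxK mulmx1 -AC.
exists (K + 1)^-1; first by rewrite invr_gt0; lra.
move=> t tK; split=> [|x x0]; first exact: symm_mxD pA.1 (symm_mxZ t sH).
rewrite -/(bilform _ _ _) bilformDm bilformZm.
have Ax : 0 < bilform A x x by exact: pA.2.
suff : `|t * bilform H x x| < bilform A x x.
  by rewrite ltr_norml => /andP[]; lra.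
rewrite normrM; apply: le_lt_trans (ler_wpM2l (normr_ge0 t) (HK x)) _.
rewrite mulrA gtr_pMl//; have := normr_ge0 t.
have : `|t| * (K + 1) < 1 by rewrite -ltr_pdivlMr ?div1r//; lra.
lra.
Qed.

End PositiveSemidefinite.

(** * Entrywise limits of traces, determinants and inverses *)

Section Limits.
Context {R : realType} {p : nat} {T : Type} (F : set_system T) {FF : Filter F}.
Implicit Types (f g : T -> 'M[R]_p) (A B H : 'M[R]_p).

Lemma cvg_mxE f A : f x @[x --> F] --> A -> forall i j, f x i j @[x --> F] --> A i j.
Proof.
move=> fA i j; apply: (@continuous_cvg _ _ _ F _ f (fun M : 'M[R]_p => M i j) A _ fA).
exact: coord_continuous.
Qed.

Lemma cvg_sumr (I : Type) (r : seq I) (P : pred I) (f : I -> T -> R) (a : I -> R) :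
  (forall i, P i -> f i x @[x --> F] --> a i) ->
  \sum_(i <- r | P i) f i x @[x --> F] --> \sum_(i <- r | P i) a i.
Proof. by apply: cvg_big; exact: add_continuous. Qed.

Lemma cvg_prodr (I : Type) (r : seq I) (P : pred I) (f : I -> T -> R) (a : I -> R) :
  (forall i, P i -> f i x @[x --> F] --> a i) ->
  \prod_(i <- r | P i) f i x @[x --> F] --> \prod_(i <- r | P i) a i.
Proof. by apply: cvg_big; exact: mul_continuous. Qed.

(** The size [n] is free so that the minors in the cofactors are covered too. *)
Lemma cvg_det n (f : T -> 'M[R]_n) (A : 'M[R]_n) :
  (forall i j, f x i j @[x --> F] --> A i j) -> \det (f x) @[x --> F] --> \det A.
Proof.
move=> fA; apply: cvg_sumr => s _; apply: cvgM; first exact: cvg_cst.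
by apply: cvg_prodr => i _; exact: fA.
Qed.

Lemma cvg_mxtrace_mul f g A B :
  (forall i j, f x i j @[x --> F] --> A i j) ->
  (forall i j, g x i j @[x --> F] --> B i j) ->
  \tr (f x *m g x) @[x --> F] --> \tr (A *m B).
Proof.
move=> fA gB; apply: cvg_sumr => i _; rewrite mxE.
under eq_fun do rewrite mxE.
by apply: cvg_sumr => j _; apply: cvgM; [exact: fA|exact: gB].
Qed.

(** By Cramer's formula each entry is a cofactor over the determinant. Invertibility near the limit
    is assumed because [invmx] returns a singular matrix unchanged. *)
Lemma cvg_invmx f A : (\forall x \near F, f x \in unitmx) -> A \in unitmx ->
  (forall i j, f x i j @[x --> F] --> A i j) ->
  forall i j, invmx (f x) i j @[x --> F] --> invmx A i j.
Proof.
move=> uf uA fA i j.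
have -> : invmx A i j = (\det A)^-1 * cofactor A j i.
  by rewrite /invmx uA !mxE.
apply: (@cvg_trans _ ((\det (f x))^-1 * cofactor (f x) j i @[x --> F])).
  apply: near_eq_cvg; near=> x; rewrite /invmx ifT ?mxE//.
  by near: x.
apply: cvgM; first by apply: cvgV; [rewrite -unitfE -unitmxE|exact: cvg_det].
apply: cvgM; first exact: cvg_cst.
apply: cvg_det => k l; rewrite !mxE.
by under eq_fun do rewrite !mxE; exact: fA.
Unshelve. all: by end_near. Qed.

End Limits.

Arguments cvg_mxE {R p T F FF f A} fA i j.

Lemma cvg_real_unique (R : realType) (T : Type) (F : set_system T) {FF : ProperFilter F}
    (f : T -> R) (a b : R) : f x @[x --> F] --> a -> f x @[x --> F] --> b -> a = b.
Proof. exact: (cvg_unique (@norm_hausdorff _ _)). Qed.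

(** * Directional derivatives of log det *)

Section Gradient.
Context {R : realType} {p : nat}.
Implicit Types (A H L S X Sigma : 'M[R]_p).

Lemma cvg_line A H i j : (t *: H + A) i j @[t --> (0 : R)^'] --> A i j.
Proof.
under eq_fun do rewrite !mxE.
have : (t * H i j + A i j) @[t --> (0 : R)^'] --> 0 * H i j + A i j.
  apply: cvgD; last exact: cvg_cst.
  apply: cvgM; last exact: cvg_cst.
  exact: cvg_within.
by rewrite mul0r add0r.
Qed.

Lemma near_posdef_line A H : posdef A -> symm_mx H ->
  \forall t \near (0 : R)^', posdef (t *: H + A).
Proof.
move=> pA sH; have [e e0 He] := posdef_line pA sH.
near=> t; rewrite addrC; apply: He.
near: t; exact: dnbhs0_lt.
Unshelve. all: by end_near. Qed.

(* Applied in both directions, the tangent inequality puts the difference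
   quotient between [\tr (H A_t^-1)] and [\tr (H A^-1)], where
   [A_t = A + t H]. *)
Lemma cvg_ln_det_quotient A H : posdef A -> symm_mx H ->
  t^-1 * (ln (\det (t *: H + A)) - ln (\det A)) @[t --> (0 : R)^']
    --> \tr (H *m invmx A).
Proof.
move=> pA sH; set l := \tr _; pose m t := \tr (H *m invmx (t *: H + A)).
have ml : m t @[t --> (0 : R)^'] --> l.
  apply: cvg_mxtrace_mul => i j; [exact: cvg_cst|apply: cvg_invmx].
  - by apply: filterS (near_posdef_line pA sH) => t; exact: posdef_unitmx.
  - exact: posdef_unitmx.
  - exact: cvg_line.
have m0 : `|m t - l| @[t --> (0 : R)^'] --> (0 : R).
  have : `|m t - l| @[t --> (0 : R)^'] --> `|l - l|.
    by apply: cvg_norm; apply: cvgB => //; exact: cvg_cst.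
  by rewrite subrr normr0.
(* Which of [m t] and [l] bounds the quotient from below depends on the sign of t; this symmetric
   envelope serves both signs. *)
apply: (@squeeze_cvgr _ _ _ _ (fun t => l - `|m t - l|) (fun t => l + `|m t - l|)).
- near=> t.
  have t0 : t != 0 by near: t; exact: nbhs_dnbhs_neq.
  have pAt : posdef (t *: H + A) by near: t; exact: near_posdef_line.
  have := ln_det_tangent pA pAt; have := ln_det_tangent pAt pA.
  rewrite addrK opprD addrCA subrr addr0 mulNmx raddfN /= -!scalemxAl !mxtraceZ.
  rewrite -/(m t) -/l; set a := ln _; set b := ln _ => h1 h2.
  have ba : b - a = t * (t^-1 * (b - a)) by rewrite mulVKf.
  move: ba h1 h2; set q := t^-1 * _ => ba h1 h2.
  have qm : t * m t <= t * q by lra.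
  have ql : t * q <= t * l by lra.
  have := ler_norm (m t - l); have := ler_norm (- (m t - l)); rewrite normrN.
  have [t_lt0|t_gt0|t_eq0] := ltgtP t 0; last by rewrite t_eq0 eqxx in t0.
  - rewrite !ler_nM2l// in qm ql; lra.
  - rewrite !ler_pM2l// in qm ql; lra.
- have : (l - `|m t - l|) @[t --> (0 : R)^'] --> l - 0.
    by apply: cvgB => //; exact: cvg_cst.
  by rewrite subr0.
- have : (l + `|m t - l|) @[t --> (0 : R)^'] --> l + 0.
    by apply: cvgD => //; exact: cvg_cst.
  by rewrite addr0.
Unshelve. all: by end_near. Qed.

End Gradient.

(* [smooth_obj mu Sigma L S = \tr L + barrier mu Sigma (L + S)], and
   [barrier_grad] is the gradient of [barrier]. *)
Definition barrier (R : realType) (p : nat) (mu : R) (Sigma X : 'M[R]_p) : R :=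
  mu * (\tr (X *m invmx Sigma) - ln (\det X)).

Definition barrier_grad (R : realType) (p : nat) (mu : R) (Sigma X : 'M[R]_p) :
    'M[R]_p :=
  mu *: (invmx Sigma - invmx X).

(** * Convexity and gradient of the barrier and of the smooth objective *)

Section Barrier.
Context {R : realType} {p : nat} (mu : R) (Sigma : 'M[R]_p).
Hypotheses (mu0 : 0 < mu) (symSigma : symm_mx Sigma).
Implicit Types (A G H L S X Y : 'M[R]_p).
Local Notation B := (barrier mu Sigma).
Local Notation dB := (barrier_grad mu Sigma).

Lemma symm_invmx A : symm_mx A -> symm_mx (invmx A).
Proof. by rewrite /symm_mx trmx_inv => ->. Qed.

Lemma symm_barrier_grad X : symm_mx X -> symm_mx (dB X).
Proof. by move=> sX; apply/symm_mxZ/symm_mxB; exact: symm_invmx. Qed.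

Lemma barrier_tangent X Y : posdef X -> posdef Y ->
  B X + \tr (dB X *m (Y - X)) <= B Y.
Proof.
move=> pX pY; have h := ln_det_tangent pX pY.
rewrite /barrier /barrier_grad -scalemxAl mxtraceZ mulmxBl raddfB /=.
rewrite [\tr (invmx X *m _)]mxtrace_mulC [\tr (invmx Sigma *m _)]mxtrace_mulC.
rewrite [(Y - X) *m invmx Sigma]mulmxBl [\tr (_ - _ *m invmx Sigma)]raddfB /= -mulrDr.
by rewrite ler_pM2l//; lra.
Qed.

Lemma cvg_barrier_quotient X H : posdef X -> symm_mx H ->
  t^-1 * (B (t *: H + X) - B X) @[t --> (0 : R)^'] --> \tr (dB X *m H).
Proof.
move=> pX sH.
apply: (@cvg_trans _ (mu * (\tr (H *m invmx Sigma) -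
    t^-1 * (ln (\det (t *: H + X)) - ln (\det X))) @[t --> (0 : R)^'])).
  apply: near_eq_cvg; near=> t.
  have t0 : t != 0 by near: t; exact: nbhs_dnbhs_neq.
  rewrite /barrier mulmxDl -scalemxAl mxtraceD mxtraceZ.
  by field.
rewrite /barrier_grad -scalemxAl mxtraceZ mulmxBl raddfB /=.
rewrite [\tr (invmx X *m _)]mxtrace_mulC [\tr (invmx Sigma *m _)]mxtrace_mulC.
apply: cvgM; first exact: cvg_cst.
by apply: cvgB; [exact: cvg_cst|exact: cvg_ln_det_quotient].
Unshelve. all: by end_near. Qed.

(** The pairing with E_ij is G_ji and with E_ji is G_ij, so the average reads off the entry, in the
    very direction used by [grad]. *)
Lemma mxtrace_sym_delta G i j : symm_mx G ->
  \tr (G *m (2^-1 *: (delta_mx i j + delta_mx j i))) = G i j.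
Proof.
move=> sG; rewrite -scalemxAr mxtraceZ mulmxDr mxtraceD.
have tr_delta k l : \tr (G *m delta_mx k l) = G l k.
  rewrite /mxtrace (bigD1 l)//= big1 => [|m ml].
    rewrite addr0 mxE (bigD1 k)//= big1 => [|n nk].
      by rewrite addr0 mxE !eqxx mulr1.
    by rewrite mxE (negPf nk) mulr0.
  by rewrite mxE big1// => n _; rewrite mxE (negPf ml) andbF mulr0.
by rewrite !tr_delta (symm_mxE sG); field.
Qed.

Lemma symm_delta i j : symm_mx (2^-1 *: (delta_mx i j + delta_mx j i) : 'M[R]_p).
Proof. by apply: symm_mxZ; rewrite /symm_mx linearD /= !trmx_delta addrC. Qed.

(** Symmetric directions suffice, since [grad] differentiates only along these. *)
Lemma gradE (g : 'M[R]_p -> R) X G : symm_mx G ->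
  (forall H, symm_mx H ->
     t^-1 * (g (t *: H + X) - g X) @[t --> (0 : R)^'] --> \tr (G *m H)) ->
  grad g X = G.
Proof.
move=> sG gG; apply/matrixP => i j; rewrite mxE -(mxtrace_sym_delta i j sG).
by apply: cvg_lim; [exact: norm_hausdorff|exact: (gG _ (symm_delta i j))].
Qed.

Lemma grad_SE L S : posdef (L + S) -> grad_S mu Sigma L S = dB (L + S).
Proof.
move=> pLS; apply: gradE => [|H sH]; first exact: symm_barrier_grad pLS.1.
apply: (cvg_trans _ (cvg_barrier_quotient pLS sH)).
apply: near_eq_cvg; near=> t; congr (_ * _).
by rewrite /smooth_obj -/(barrier _ _ _) addrCA opprD addrACA subrr add0r.
Unshelve. all: by end_near. Qed.

Lemma grad_LE L S : posdef (L + S) -> grad_L mu Sigma L S = 1%:M + dB (L + S).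
Proof.
move=> pLS; apply: gradE => [|H sH].
  by apply: symm_mxD (symm_barrier_grad pLS.1); rewrite /symm_mx trmx1.
rewrite mulmxDl mul1mx mxtraceD.
apply: (@cvg_trans _ (\tr H + t^-1 * (B (t *: H + (L + S)) - B (L + S))
    @[t --> (0 : R)^'])).
  apply: near_eq_cvg; near=> t.
  have t0 : t != 0 by near: t; exact: nbhs_dnbhs_neq.
  rewrite /smooth_obj -(addrA (t *: H)) -!/(barrier _ _ _) mxtraceD mxtraceZ.
  by field.
by apply: cvgD; [exact: cvg_cst|exact: cvg_barrier_quotient].
Unshelve. all: by end_near. Qed.

Lemma cvg_barrier_grad (T : Type) (F : set_system T) (FF : Filter F)
    (f : T -> 'M[R]_p) X : (forall x, posdef (f x)) -> posdef X ->
  (forall i j, f x i j @[x --> F] --> X i j) ->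
  forall i j, dB (f x) i j @[x --> F] --> dB X i j.
Proof.
move=> pf pX fX i j; rewrite !mxE; under eq_fun do rewrite !mxE.
apply: cvgM; first exact: cvg_cst.
apply: cvgB; first exact: cvg_cst.
apply: cvg_invmx => //; last exact: posdef_unitmx.
by near=> x; exact: posdef_unitmx.
Unshelve. all: by end_near. Qed.

End Barrier.

(** * Frobenius inner product, projection onto the cone, and optimality in the L-step *)

Section FrobeniusInner.
Context {R : realType} {p : nat}.
Implicit Types (A B G H M P S Q W : 'M[R]_p).

Lemma innerE A B : inner A B = \sum_i \sum_j A i j * B i j.
Proof.
by apply: eq_bigr => i _; rewrite mxE; apply: eq_bigr => j _; rewrite mxE.
Qed.

Lemma inner_symm A B : symm_mx B -> inner A B = \tr (A *m B).
Proof. by rewrite /inner => ->. Qed.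

Lemma innerC A B : inner A B = inner B A.
Proof. by rewrite /inner -mxtrace_tr trmx_mul trmxK. Qed.

Lemma innerDl A B H : inner (A + B) H = inner A H + inner B H.
Proof. by rewrite /inner mulmxDl mxtraceD. Qed.

Lemma innerDr A B H : inner H (A + B) = inner H A + inner H B.
Proof. by rewrite /inner linearD mulmxDr mxtraceD. Qed.

Lemma innerZl a A H : inner (a *: A) H = a * inner A H.
Proof. by rewrite /inner -scalemxAl mxtraceZ. Qed.

Lemma innerZr a A H : inner H (a *: A) = a * inner H A.
Proof. by rewrite /inner linearZ -scalemxAr mxtraceZ. Qed.

Lemma inner_line A W t :
  inner (t *: W + A) (t *: W + A) = inner A A + 2 * t * inner A W + t ^+ 2 * inner W W.
Proof.
by rewrite innerDl !innerDr !innerZl !innerZr (innerC W A); ring.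
Qed.

Lemma inner_ge_sqr A i j : A i j ^+ 2 <= inner A A.
Proof.
rewrite innerE (bigD1 i)//= (bigD1 j)//= -expr2 -addrA lerDl.
by apply: addr_ge0; apply: sumr_ge0 => k _; [|apply: sumr_ge0 => l _];
  rewrite -expr2 sqr_ge0.
Qed.

Lemma inner_ge0 A : 0 <= inner A A.
Proof. by rewrite innerE; do 2!apply: sumr_ge0 => ? _; rewrite -expr2 sqr_ge0. Qed.

Lemma inner_eq0 A : inner A A <= 0 -> A = 0.
Proof.
move=> A0; apply/matrixP => i j; rewrite mxE; apply/eqP.
by rewrite -sqrf_eq0 eq_le sqr_ge0 (le_trans (inner_ge_sqr _ _ _)).
Qed.

Lemma frob_sqr A : frob A ^+ 2 = inner A A.
Proof. by rewrite /frob sqr_sqrtr// inner_ge0. Qed.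

Lemma entry_le_frob2 A B i j : `|B i j| <= frob2 A B.
Proof.
rewrite /frob2 -sqrtr_sqr; apply: ler_wsqrtr.
by rewrite !frob_sqr (le_trans (inner_ge_sqr _ _ _))// lerDr inner_ge0.
Qed.

Lemma right_slope_ge0 (a w : R) :
  (forall t, 0 < t <= 1 -> 0 <= 2 * t * a + t ^+ 2 * w) -> 0 <= a.
Proof.
move=> ht; rewrite leNgt; apply/negP => a0.
(* For a < 0 this c lies in (0, 1] and satisfies c w <= - a, so 2 a + c w <= a < 0. *)
pose c := - a / (`|w| - a).
have wa : 0 < `|w| - a by have := normr_ge0 w; lra.
have c0 : 0 < c by rewrite divr_gt0// oppr_gt0.
have c1 : c <= 1 by rewrite ler_pdivrMr//; have := normr_ge0 w; lra.
have : 0 <= 2 * c * a + c ^+ 2 * w by apply: ht; rewrite c0.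
have -> : 2 * c * a + c ^+ 2 * w = c * (2 * a + c * w) by ring.
rewrite pmulr_rge0//; have cw : c * w <= c * (`|w| - a).
  by rewrite ler_wpM2l ?(ltW c0)//; have := ler_norm w; lra.
by move: cw; rewrite divfK ?gt_eqF//; lra.
Qed.

(** The variational inequality of a projection: compare the distances at P and at P + t W to first
    order. Only t <= 1 is asked, so that W = - P is an admissible direction. *)
Lemma psd_proj_optim M P W : psd_proj M P ->
  (forall t, 0 < t <= 1 -> psd (P + t *: W)) -> 0 <= inner (P - M) W.
Proof.
move=> [_ minP] pW; apply: (@right_slope_ge0 _ (inner W W)) => t t01.
have := minP _ (pW t t01).
have -> : M - (P + t *: W) = (- t) *: W + (M - P).
  by rewrite opprD addrA addrC scaleNr.
rewrite ler_sqrt ?inner_ge0// inner_line sqrrN.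
have -> : inner (P - M) W = - inner (M - P) W.
  by rewrite -(opprB M P) -scaleN1r innerZl mulN1r.
lra.
Qed.

(* Moreau decomposition [M = P - (P - M)] for the self-dual cone of positive
   semidefinite matrices. *)
Lemma psd_proj_moreau M P : symm_mx M -> psd_proj M P ->
  psd (P - M) /\ \tr ((P - M) *m P) = 0.
Proof.
move=> sM projP; have pP := projP.1; split.
  split=> [|x]; first exact: symm_mxB pP.1 sM.
  rewrite -/(bilform _ _ _) -mxtrace_outer -inner_symm; last exact: symm_outer.
  apply: (psd_proj_optim projP) => t /andP[/ltW t0 _].
  by apply: psdD => //; apply: psdZ => //; exact: psd_outer.
(* The directions P and - P both stay in the cone, which forces orthogonality. *)
have ge0 : 0 <= inner (P - M) P.
  apply: (psd_proj_optim projP) => t /andP[/ltW t0 _].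
  by apply: psdD => //; exact: psdZ.
have le0 : 0 <= inner (P - M) (-1 *: P).
  apply: (psd_proj_optim projP) => t /andP[_ t1].
  have -> : P + t *: (-1 *: P) = (1 - t) *: P.
    by rewrite scalerA mulrN1 scaleNr scalerBl scale1r.
  by apply: psdZ => //; rewrite subr_ge0.
rewrite -inner_symm; last exact: pP.1.
by apply/eqP; rewrite eq_le ge0 andbT; move: le0; rewrite innerZr; lra.
Qed.

(** The minimizer is interior along symmetric lines, so the right derivative in the direction - G,
    with G the gradient of the subproblem, is nonnegative; it equals - <G, G>, hence G = 0. *)
Lemma L_argmin_stationary (mu rho : R) (Sigma S U Lam L : 'M[R]_p) :
  0 < mu -> symm_mx Sigma -> symm_mx U -> symm_mx Lam ->
  L_argmin mu rho Sigma S U Lam L ->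
  Lam = 1%:M + barrier_grad mu Sigma (L + S) + rho *: (L - U).
Proof.
move=> mu0 sSigma sU sLam [[sL pLS] minL].
pose G := 1%:M + barrier_grad mu Sigma (L + S) + rho *: (L - U) - Lam.
have s1 : symm_mx (1%:M : 'M[R]_p) by rewrite /symm_mx trmx1.
have sG : symm_mx G.
  apply: symm_mxB => //; apply: symm_mxD; last exact/symm_mxZ/symm_mxB.
  by apply: symm_mxD => //; exact: symm_barrier_grad pLS.1.
apply/eqP; rewrite eq_sym -subr_eq0; apply/eqP; rewrite -/G; apply: inner_eq0.
pose H := -1 *: G; have sH : symm_mx H by exact: symm_mxZ.
pose c := \tr H - inner Lam H + rho * inner (L - U) H.
pose q t := t^-1 * (barrier mu Sigma (t *: H + (L + S)) - barrier mu Sigma (L + S)).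
have sub_line t : L_subproblem mu rho Sigma S U Lam (t *: H + L)
    = t * \tr H + \tr L + barrier mu Sigma (t *: H + (L + S))
      - (t * inner Lam H + inner Lam L)
      + rho / 2 * (inner (L - U) (L - U) + 2 * t * inner (L - U) H
                   + t ^+ 2 * inner H H).
  rewrite /L_subproblem /smooth_obj frob_sqr -(addrA _ L (- U)) inner_line.
  rewrite mxtraceD mxtraceZ (innerDr _ _ Lam) (innerZr _ _ Lam).
  by rewrite -(addrA (t *: H) L S).
have qc : q t + c + rho / 2 * t * inner H H @[t --> (0 : R)^'+]
    --> \tr (barrier_grad mu Sigma (L + S) *m H) + c + rho / 2 * 0 * inner H H.
  apply: cvgD; last first.
    apply: cvgM; last exact: cvg_cst.
    apply: cvgM; first exact: cvg_cst.
    exact: cvg_within.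
  apply: cvgD; last exact: cvg_cst.
  by apply: cvg_dnbhs_at_right; exact: cvg_barrier_quotient.
have slope : 0 <= \tr (barrier_grad mu Sigma (L + S) *m H) + c + rho / 2 * 0 * inner H H.
  have [e e0 He] := posdef_line pLS sH.
  (* For small t > 0 the moved point stays in the domain; minimality divided by t bounds the
     quotient. *)
  apply: (cvgr_to_ge qc); near=> t.
  have t0 : 0 < t by near: t; exact: nbhs_right_gt.
  have pt : posdef (t *: H + (L + S)).
    rewrite addrC; apply: He; rewrite (gtr0_norm t0).
    by near: t; exact: nbhs_right_lt.
  have := minL (t *: H + L) (symm_mxD (symm_mxZ t sH) sL).
  rewrite -(addrA _ L S) => /(_ pt); rewrite sub_line.
  rewrite /L_subproblem /smooth_obj frob_sqr -/(barrier mu Sigma (L + S)).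
  have -> : barrier mu Sigma (t *: H + (L + S))
      = t * q t + barrier mu Sigma (L + S) by rewrite /q mulVKf ?gt_eqF// subrK.
  move=> h; rewrite -(pmulr_rge0 _ t0) /c.
  lra.
have -> : inner G G = - inner G H by rewrite innerZr; ring.
rewrite oppr_le0 /G innerDl -(scaleN1r Lam) innerZl !innerDl.
have -> : inner 1%:M H = \tr H by rewrite inner_symm// mul1mx.
rewrite (inner_symm _ sH) innerZl.
by move: slope; rewrite /c; lra.
Unshelve. all: by end_near. Qed.

End FrobeniusInner.

(** * Limits of hard thresholding *)

Lemma hard_threshold_limit (R : realType) (T : Type) (F : set_system T)
    {FF : ProperFilter F} (s t : T -> R) (a b r : R) : 0 <= r ->
  (forall x, s x = if `|t x| <= r then 0 else t x) ->
  s x @[x --> F] --> a -> t x @[x --> F] --> b ->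
  (a = 0 -> `|b| <= r) /\ (a != 0 -> a = b /\ r <= `|a|).
Proof.
move=> r0 st sa tb; split=> a0.
  (* If |b| > r, the values [t x] eventually survive the threshold, so b = a = 0, a
     contradiction. *)
  rewrite leNgt; apply/negP => rb.
  have b0 : b = 0.
    rewrite -a0; apply: (cvg_unique (@norm_hausdorff _ _) tb).
    apply: cvg_trans sa; apply: near_eq_cvg; near=> x.
    rewrite st ifN// -ltNge.
    near: x; exact: (cvgr_norm_gt _ tb _ rb).
  by move: rb; rewrite b0 normr0 ltNge r0.
(* Near the limit [s x] is nonzero, hence was not thresholded; the strict bound by [r] becomes weak
   in the limit. *)
have ts : \forall x \near F, s x = t x /\ r <= `|s x|.
  near=> x.
  have : s x != 0 by near: x; exact: (cvgr_neq0 _ sa).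
  by rewrite st; case: ifPn; rewrite ?eqxx// -ltNge => /ltW.
split; last by apply: (cvgr_to_ge (cvg_norm sa)); apply: filterS ts => x [].
apply: (cvg_unique (@norm_hausdorff _ _) sa).
apply: cvg_trans tb; apply: near_eq_cvg.
by apply: filterS ts => x [].
Unshelve. all: by end_near. Qed.

(** * From P-stationarity to local minimality *)

Lemma finite_lower_bound (R : realType) (I : finType) (e : I -> R) :
  (forall i, 0 < e i) -> exists2 d : R, 0 < d & forall i, d <= e i.
Proof.
move=> e0; exists (\big[Num.min/1]_i e i).
  by elim/big_ind: _ => // x y x0 y0; rewrite lt_min x0.
by move=> i; exact: bigmin_le_cond.
Qed.

Lemma norm0E (R : realType) (p : nat) (S : 'M[R]_p) :
  norm0 S = \sum_i \sum_j (S i j != 0)%:R.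
Proof.
rewrite /norm0 -sum1_card natr_sum pair_bigA /= big_mkcond /=.
by apply: eq_bigr => -[i j] _; rewrite inE /=; case: ifP.
Qed.

(** The barrier depends only on L + S, so its tangent term splits into an L-part and an S-part with
    the same gradient; the trace of L is linear. *)
Lemma smooth_obj_tangent (R : realType) (p : nat) (mu : R)
    (Sigma L S L' S' : 'M[R]_p) : 0 < mu ->
  posdef (L + S) -> posdef (L' + S') ->
  smooth_obj mu Sigma L S
    + \tr ((1%:M + barrier_grad mu Sigma (L + S)) *m (L' - L))
    + \tr (barrier_grad mu Sigma (L + S) *m (S' - S))
  <= smooth_obj mu Sigma L' S'.
Proof.
move=> mu0 p1 p2; have := barrier_tangent Sigma mu0 p1 p2.
rewrite opprD addrACA mulmxDr mxtraceD mulmxDl mul1mx mxtraceD raddfB /=.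
rewrite /smooth_obj -!/(barrier _ _ _); lra.
Qed.

(* By convexity of [smooth_obj] and the sign of the multipliers, a feasible
   move changes the objective by at least
   [\sum_ij G_ij (S'_ij - S_ij) + C (||S'||_0 - ||S||_0)], where
   [G = N - Th], with [N] the gradient in [S], vanishes on the support of [S].
   For a small move the support can only grow, and each new nonzero entry costs
   [C], more than the linear term can gain. *)
Lemma P_stationary_local_minimizer (R : realType) (p : nat) (C mu : R)
    (Sigma Ls Ss : 'M[R]_p) :
  0 < C -> 0 < mu -> symm_mx Sigma ->
  P_stationary C mu Sigma Ls Ss -> local_minimizer C mu Sigma Ls Ss.
Proof.
move=> C0 mu0 sSigma [Lam [Th [gamma [[gamma0 _ _]]]]].
move=> [[pL pS pLS] [[pLam pTh LamL ThS]]].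
rewrite grad_LE// grad_SE//; set N := barrier_grad _ _ _; move=> [/eqP LamE proxS].
split; first by split.
move: LamE; rewrite subr_eq0 => /eqP LamE.
pose G := N - Th.
have G0 i j : Ss i j != 0 -> G i j = 0.
  have : prox0 gamma C (Ss - gamma *: G) i j = Ss i j by rewrite proxS.
  rewrite !mxE -/(G i j); case: ifP => _; first by move=> <-; rewrite eqxx.
  move=> h _; apply/eqP; rewrite -(mulrI_eq0 _ (lregP (lt0r_neq0 gamma0))).
  by apply/eqP; lra.
(* On the support, |S_ij - Ss_ij| < |Ss_ij| keeps the entry nonzero; off it, |S_ij| < C / (|G_ij| +
   1) bounds the linear term by C. *)
have [d d0 dP] : exists2 d : R, 0 < d & forall ij : 'I_p * 'I_p,
    d <= if Ss ij.1 ij.2 == 0 then C / (`|G ij.1 ij.2| + 1) else `|Ss ij.1 ij.2|.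
  apply: finite_lower_bound => -[i j] /=; case: ifPn => [_|]; last by rewrite normr_gt0.
  by rewrite divr_gt0// ltr_wpDl.
exists d => // L S [pL' pS' pLS'] dist.
have entry i j : 0 <= G i j * (S i j - Ss i j)
    + C * ((S i j != 0)%:R - (Ss i j != 0)%:R).
  have := dP (i, j); have : `|S i j - Ss i j| < d.
    by apply: le_lt_trans dist; have := entry_le_frob2 (L - Ls) (S - Ss) i j; rewrite !mxE.
  rewrite /=; case: (eqVneq (Ss i j) 0) => [->|Sij]; last first.
    rewrite G0// mul0r add0r => lt_d d_le.
    case: (eqVneq (S i j) 0) => [Sij0|]; last by rewrite subrr mulr0.
    by move: lt_d; rewrite Sij0 sub0r normrN ltNge d_le.
  rewrite !subr0; case: (eqVneq (S i j) 0) => [->|_]; first by rewrite !mulr0 addr0.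
  rewrite mulr1 => lt_d d_le; suff : `|G i j * S i j| <= C.
    by rewrite ler_norml => /andP[]; lra.
  have G1 : 0 < `|G i j| + 1 by rewrite ltr_wpDl.
  have : `|S i j| * (`|G i j| + 1) <= C.
    by rewrite -ler_pdivlMr// ltW// (lt_le_trans lt_d).
  by rewrite normrM; have := normr_ge0 (S i j); nra.
(* Complementarity removes the multiplier terms at the stationary point; those at the competitor are
   nonnegative traces of products of semidefinite matrices. *)
have := smooth_obj_tangent Sigma mu0 pLS pLS'; rewrite -/N LamE.
have -> : \tr (Lam *m (L - Ls)) = \tr (Lam *m L).
  by rewrite mulmxBr raddfB /= LamL subr0.
have -> : \tr (N *m (S - Ss)) = inner G (S - Ss) + \tr (Th *m S).
  rewrite inner_symm; last exact: symm_mxB pS'.1 pS.1.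
  have -> : \tr (Th *m S) = \tr (Th *m (S - Ss)).
    by rewrite mulmxBr raddfB /= ThS subr0.
  by rewrite /G mulmxBl [\tr (N *m _ - _)]raddfB /= subrK.
have := psd_trace_mul_ge0 pLam pL'; have := psd_trace_mul_ge0 pTh pS'.
have : 0 <= inner G (S - Ss) + C * (norm0 S - norm0 Ss).
  rewrite innerE !norm0E -sumrB mulr_sumr -big_split /=; apply: sumr_ge0 => i _.
  rewrite -sumrB mulr_sumr -big_split /=; apply: sumr_ge0 => j _.
  by have := entry i j; rewrite !mxE.
rewrite /obj; lra.
Qed.

(** * Passage to the limit in the ADMM iteration *)

Unset Implicit Arguments.

Theorem proposition6 (R : realType) (p : nat) (hp : (0 < p)%N)
    (C mu : R) (hC : 0 < C) (hmu : 0 < mu)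
    (Sigma : 'M[R]_p) (hSigma : posdef Sigma)
    (rho gamma : R) (hrho : 0 < rho) (hgamma : 0 < gamma)
    (L S U V Lam Theta : nat -> 'M[R]_p)
    (hadmm : l0_admm C mu Sigma rho gamma L S U V Lam Theta)
    (Ls Ss Us Vs Lams Thetas : 'M[R]_p)
    (hL : L k @[k --> \oo] --> Ls)
    (hS : S k @[k --> \oo] --> Ss)
    (hU : U k @[k --> \oo] --> Us)
    (hV : V k @[k --> \oo] --> Vs)
    (hLam : Lam k @[k --> \oo] --> Lams)
    (hTheta : Theta k @[k --> \oo] --> Thetas)
    (hfeas : feasible Ls Ss) :
  P_stationary C mu Sigma Ls Ss /\ local_minimizer C mu Sigma Ls Ss.
Proof.
have sSigma := hSigma.1; have [pLs pSs pLSs] := hfeas.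
have cvgS (f : nat -> 'M[R]_p) (A : 'M[R]_p) : f k @[k --> \oo] --> A ->
    f k.+1 @[k --> \oo] --> A by rewrite cvg_shiftS.
have pLS k : posdef (L k.+1 + S k) by have [[]] := admm_L hadmm k.
have sL k : symm_mx (L k.+1) by have [[]] := admm_L hadmm k.
(* Symmetry of [S k] is read off from the domain condition of the next L-step. *)
have sS k : symm_mx (S k).
  have -> : S k = (L k.+1 + S k) - L k.+1 by rewrite addrC addKr.
  exact: symm_mxB (pLS k).1 (sL k).
have sU k : symm_mx (U k.+1) by have [[]] := admm_U hadmm k.
have sV k : symm_mx (V k.+1) by have [[]] := admm_V hadmm k.
have sLam k : symm_mx (Lam k).
  elim: k => [|k IHk]; first by rewrite (admm_Lam0 hadmm) /symm_mx trmx0.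
  by rewrite (admm_Lam hadmm); apply/symm_mxB/symm_mxZ/symm_mxB.
have sTheta k : symm_mx (Theta k).
  elim: k => [|k IHk]; first by rewrite (admm_Theta0 hadmm) /symm_mx trmx0.
  by rewrite (admm_Theta hadmm); apply/symm_mxB/symm_mxZ/symm_mxB.
have [psdLam psdTheta LamU ThetaV] : [/\ forall k, psd (Lam k.+1),
    forall k, psd (Theta k.+1), forall k, \tr (Lam k.+1 *m U k.+1) = 0
    & forall k, \tr (Theta k.+1 *m V k.+1) = 0].
  (* The multiplier update rewrites as Y = rho (P - (M - X / rho)), a positive multiple of the
     Moreau residual. *)
  have moreau (M P X Y : 'M[R]_p) : symm_mx M -> symm_mx X -> Y = X - rho *: (M - P) ->
      psd_proj (M - rho^-1 *: X) P -> psd Y /\ \tr (Y *m P) = 0.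
    move=> sM sX YE projP.
    have [|pP tP] := psd_proj_moreau _ projP; first exact/symm_mxB/symm_mxZ.
    have -> : Y = rho *: (P - (M - rho^-1 *: X)).
      by rewrite YE !scalerBr scalerA mulfV ?gt_eqF// scale1r !opprB addrCA.
    by rewrite -scalemxAl mxtraceZ tP mulr0; split => //; apply: psdZ => //; exact: ltW.
  split=> k.
  - by have [] := moreau _ _ _ _ (sL k) (sLam k) (admm_Lam hadmm k) (admm_U hadmm k).
  - by have [] := moreau _ _ _ _ (sS k.+1) (sTheta k) (admm_Theta hadmm k) (admm_V hadmm k).
  - by have [] := moreau _ _ _ _ (sL k) (sLam k) (admm_Lam hadmm k) (admm_U hadmm k).
  - by have [] := moreau _ _ _ _ (sS k.+1) (sTheta k) (admm_Theta hadmm k) (admm_V hadmm k).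
(* Increments of a convergent multiplier tend to zero, and they are - rho times the residual. *)
have residual (X Y Z : nat -> 'M[R]_p) (Xs Ys Zs : 'M[R]_p) :
    (forall k, X k.+1 = X k - rho *: (Y k.+1 - Z k.+1)) ->
    X k @[k --> \oo] --> Xs -> Y k @[k --> \oo] --> Ys -> Z k @[k --> \oo] --> Zs ->
    Ys = Zs.
  move=> XE cX cY cZ; apply/matrixP => i j.
  have Xij : X k.+1 i j @[k --> \oo] --> Xs i j - rho * (Ys i j - Zs i j).
    under eq_fun do rewrite XE !mxE.
    apply: cvgB; first exact: cvg_mxE cX _ _.
    apply: cvgM; first exact: cvg_cst.
    by apply: cvgB; [exact: cvg_mxE (cvgS _ _ cY) _ _|exact: cvg_mxE (cvgS _ _ cZ) _ _].
  have XsE : Xs i j = Xs i j - rho * (Ys i j - Zs i j).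
    exact: cvg_real_unique (cvg_mxE (cvgS _ _ cX) i j) Xij.
  have /eqP : rho * (Ys i j - Zs i j) = 0 by lra.
  by rewrite mulf_eq0 gt_eqF//= subr_eq0 => /eqP.
have LU := residual _ _ _ _ _ _ (admm_Lam hadmm) hLam hL hU.
have SV := residual _ _ _ _ _ _ (admm_Theta hadmm) hTheta hS hV.
have psd_lim (X : nat -> 'M[R]_p) (Xs : 'M[R]_p) : (forall k, psd (X k.+1)) ->
    X k @[k --> \oo] --> Xs -> psd Xs.
  move=> pX /cvgS lim; have cX i j : X k.+1 i j @[k --> \oo] --> Xs i j.
    exact: cvg_mxE lim i j.
  split=> [|x].
    apply/matrixP => i j; rewrite mxE.
    have cji : X k.+1 j i @[k --> \oo] --> Xs i j.
      by under eq_fun do rewrite (symm_mxE (pX _).1); exact: cX.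
    exact: cvg_real_unique (cX j i) cji.
  rewrite -/(bilform _ _ _) -mxtrace_outer.
  have cB : \tr (X k.+1 *m (x *m x^T)) @[k --> \oo] --> \tr (Xs *m (x *m x^T)).
    by apply: cvg_mxtrace_mul => // i j; exact: cvg_cst.
  apply: (cvgr_to_ge cB).
  by near=> k; rewrite mxtrace_outer psd_ge0.
have trace_lim (X Y : nat -> 'M[R]_p) (Xs Ys : 'M[R]_p) :
    (forall k, \tr (X k.+1 *m Y k.+1) = 0) ->
    X k @[k --> \oo] --> Xs -> Y k @[k --> \oo] --> Ys -> \tr (Xs *m Ys) = 0.
  move=> XY cX cY.
  have tXY : \tr (X k.+1 *m Y k.+1) @[k --> \oo] --> \tr (Xs *m Ys).
    exact: cvg_mxtrace_mul (cvg_mxE (cvgS _ _ cX)) (cvg_mxE (cvgS _ _ cY)).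
  apply: (cvg_real_unique tXY).
  by under eq_fun do rewrite XY; exact: cvg_cst.
have pLams := psd_lim _ _ psdLam hLam.
have pThetas := psd_lim _ _ psdTheta hTheta.
have cLS i j : (L k.+1 + S k) i j @[k --> \oo] --> (Ls + Ss) i j.
  under eq_fun do rewrite mxE.
  rewrite mxE; apply: cvgD; first exact: cvg_mxE (cvgS _ _ hL) _ _.
  exact: cvg_mxE hS _ _.
pose N := barrier_grad mu Sigma (Ls + Ss).
have cN i j : barrier_grad mu Sigma (L k.+1 + S k) i j @[k --> \oo] --> N i j.
  exact: cvg_barrier_grad.
have LamsE : Lams = 1%:M + N.
  apply/matrixP => i j.
  apply: (@cvg_real_unique _ _ _ _ _ _ _ (cvg_mxE (cvgS _ _ hLam) i j)).
  (* The L-step is used at index k + 1, where [U k.+1] is a projection and hence symmetric. *)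
  have LamE k : Lam k.+1 i j = (1%:M : 'M[R]_p) i j
      + barrier_grad mu Sigma (L k.+2 + S k.+1) i j + rho * (L k.+2 i j - U k.+1 i j).
    rewrite [in LHS](L_argmin_stationary hmu sSigma (sU k) (sLam k.+1) (admm_L hadmm k.+1)).
    by rewrite !mxE.
  under eq_fun do rewrite LamE.
  have -> : (1%:M + N) i j = (1%:M : 'M[R]_p) i j + N i j + rho * (Ls i j - Us i j).
    by rewrite LU subrr mulr0 addr0 mxE.
  apply: cvgD.
    apply: cvgD; first exact: cvg_cst.
    by have := cN i j; rewrite -cvg_shiftS.
  apply: cvgM; first exact: cvg_cst.
  by apply: cvgB; [exact: cvg_mxE (cvgS _ _ (cvgS _ _ hL)) _ _
                  |exact: cvg_mxE (cvgS _ _ hU) _ _].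
pose G := N - Thetas.
pose r := Num.sqrt (2 * gamma * C).
have threshold i j : (Ss i j = 0 -> gamma * `|G i j| <= r) /\
    (Ss i j != 0 -> G i j = 0 /\ r <= `|Ss i j|).
  pose t k := S k i j - gamma * (barrier_grad mu Sigma (L k.+1 + S k) i j - Theta k i j
    + rho * (S k i j - V k i j)).
  have tS k : S k.+1 i j = if `|t k| <= r then 0 else t k.
    rewrite (admm_S hadmm) grad_SE// /t; move: (barrier_grad _ _ _) => B.
    by rewrite !mxE.
  have ct : t k @[k --> \oo] --> Ss i j - gamma * (G i j + rho * (Ss i j - Vs i j)).
    apply: cvgB; first exact: cvg_mxE hS _ _.
    apply: cvgM; first exact: cvg_cst.
    apply: cvgD.
      by rewrite /G !mxE; apply: cvgB; [have := cN i j; rewrite !mxE|exact: cvg_mxE hTheta _ _].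
    apply: cvgM; first exact: cvg_cst.
    by apply: cvgB; [exact: cvg_mxE hS _ _|exact: cvg_mxE hV _ _].
  have := hard_threshold_limit (sqrtr_ge0 _) tS (cvg_mxE (cvgS _ _ hS) i j) ct.
  rewrite -SV subrr mulr0 addr0 => -[zero nonzero]; split=> Sij.
    by have := zero Sij; rewrite Sij sub0r normrN normrM gtr0_norm.
  have [GE rS] := nonzero Sij; split => //.
  have /eqP : gamma * G i j = 0 by lra.
  by rewrite mulf_eq0 gt_eqF//= => /eqP.
(* At an entry with [`|Ss i j| = r] the operator [prox0 gamma C] selects 0,
   so that stationarity may fail for [gamma] itself; it holds for any smaller
   step. *)
have stat : P_stationary C mu Sigma Ls Ss.
  exists Lams, Thetas, (gamma / 2).
  split; first by split; [exact: divr_gt0|exact: pLams.1|exact: pThetas.1].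
  split=> //; split.
    split=> //; first by rewrite LU; exact: trace_lim LamU hLam hU.
    by rewrite SV; exact: trace_lim ThetaV hTheta hV.
  rewrite grad_LE// grad_SE// -/N LamsE subrr; split=> //.
  rewrite -/G; apply/matrixP => i j; rewrite [LHS]mxE.
  have -> : (Ss - (gamma / 2) *: G) i j = Ss i j - gamma / 2 * G i j by rewrite !mxE.
  have [zero nonzero] := threshold i j.
  set r' := Num.sqrt _.
  have r'0 : 0 < r' by rewrite sqrtr_gt0 !mulr_gt0 ?invr_gt0.
  (* Halving the step gives r' < r <= 2 r': nonzero entries, at least r in size, now lie strictly
     above the threshold, and zero entries satisfy gamma / 2 * |G_ij| <= r / 2 <= r'. *)
  have rr' : r ^+ 2 = 2 * r' ^+ 2.
    by rewrite !sqr_sqrtr ?mulr_ge0 ?invr_ge0 ?ltW//; field.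
  have r0 : 0 <= r := sqrtr_ge0 _.
  have [Sij|Sij] := eqVneq (Ss i j) 0.
    rewrite ifT// Sij sub0r normrN normrM gtr0_norm ?divr_gt0//.
    have : r <= 2 * r' by nra.
    by have := zero Sij; lra.
  have [-> rS] := nonzero Sij; rewrite mulr0 subr0 ifN// -ltNge.
  by apply: lt_le_trans rS; nra.
by split => //; exact: P_stationary_local_minimizer.
Unshelve. all: by end_near. Qed.
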